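(* There exist connected finite simple graphs without isolated nodes that are not weakly locally common.
   Context: A kernel is a bounded measurable symmetric function $W:[0,1]^2\to\mathbb{R}$. Let $\mathcal{W}_1$ denote the set of kernels with values in $[-1,1]$. For a finite simple graph $F$ and a kernel $W$, define $$t(F,W)=\int_{[0,1]^{V(F)}}\prod_{ij\in E(F)}W(x_i,x_j)\prod_{i\in V(F)}dx_i .$$ Here $1\pm\varepsilon U$ denotes the kernel $(x,y)\mapsto 1\pm\varepsilon U(x,y)$. A simple graph $F$ is weakly locally common if for every $U\in\mathcal{W}_1$ there is an $\varepsilon_U>0$ such that $t(F,1+\varepsilon U)+t(F,1-\varepsilon U)\ge 2$ for all $0\le\varepsilon\le\varepsilon_U$. *)

(* Defs.v *)
From HB Require Import structures.
From mathcomp Require Import all_boot all_order all_algebra.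
From mathcomp Require Import all_classical all_reals all_analysis.
Set Implicit Arguments.
Unset Strict Implicit.
Unset Printing Implicit Defensive.
Import Order.TTheory GRing.Theory Num.Theory.
Import numFieldNormedType.Exports.
Local Open Scope classical_set_scope.
Local Open Scope ring_scope.

Record sgraph := SGraph {
  vertex :> finType;
  adj : rel vertex;
  adj_sym : symmetric adj;
  adj_irr : irreflexive adj
}.

Definition connected_graph (F : sgraph) : Prop :=
  (0 < #|F|)%N /\ forall x y : F, connect (@adj F) x y.

Definition no_isolated_node (F : sgraph) : Prop :=
  forall x : F, exists y : F, adj x y.

Section tuple_product.
Context d (T : measurableType d) (R : realType) (n : nat).

Definition tuple_cons (p : T * n.-tuple T) : n.+1.-tuple T :=
  [tuple of p.1 :: p.2].

Lemma measurable_tuple_cons : measurable_fun setT tuple_cons.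
Proof. by apply: (@measurable_cons _ _ _ _ fst n snd). Qed.

HB.instance Definition _ :=
  @isMeasurableFun.Build _ _ _ _ tuple_cons measurable_tuple_cons.

Variables (mu : {sigma_finite_measure set T -> \bar R})
  (nu : {sigma_finite_measure set (n.-tuple T) -> \bar R}).

(* mu \x nu, transported along T * T^n = T^(n+1) *)
Definition cons_measure : set (n.+1.-tuple T) -> \bar R :=
  pushforward (mu \x nu)%E tuple_cons.

Let cons_measure0 : cons_measure set0 = 0%E.
Proof. by rewrite /cons_measure /pushforward preimage_set0 measure0. Qed.

Let cons_measure_ge0 A : (0 <= cons_measure A)%E.
Proof. exact: measure_ge0. Qed.

Let cons_measure_sigma_additive : semi_sigma_additive cons_measure.
Proof. exact: measure_semi_sigma_additive. Qed.

HB.instance Definition _ := isMeasure.Build _ _ _ cons_measure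
  cons_measure0 cons_measure_ge0 cons_measure_sigma_additive.

Let cons_measure_sigma_finite : sigma_finite setT cons_measure.
Proof.
have /sigma_finiteP[F [FT ndF Foo]] := sigma_finiteT mu.
have /sigma_finiteP[G [GT ndG Goo]] := sigma_finiteT nu.
pose uncons (t : n.+1.-tuple T) : T * n.-tuple T :=
  (thead t, [tuple of behead t]).
have tcK : cancel tuple_cons uncons.
  by move=> [x t]; congr pair; exact: val_inj.
have muncons : measurable_fun setT uncons.
  apply: measurable_fun_pair; first exact: measurable_tnth.
  exact: measurable_behead.
exists (fun k => uncons @^-1` (F k `*` G k)) => [|k].
  rewrite predeqE => t; split => // _.
  have [i _ Fi] : (\bigcup_k F k) (thead t) by rewrite -FT.
  have [j _ Gj] : (\bigcup_k G k) [tuple of behead t] by rewrite -GT.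
  exists (maxn i j) => //; split => /=.
    by move: Fi; exact/subsetPset/ndF/leq_maxl.
  by move: Gj; exact/subsetPset/ndG/leq_maxr.
have [mF Fk] := Foo k; have [mG Gk] := Goo k; split.
  by rewrite -[X in measurable X]setTI; apply: muncons => //; exact: measurableX.
rewrite /cons_measure /pushforward -comp_preimage.
rewrite (_ : uncons \o tuple_cons = id) ?preimage_id; last exact/funext.
by rewrite product_measure1E// lte_mul_pinfty// ge0_fin_numE.
Qed.

HB.instance Definition _ := Measure_isSigmaFinite.Build _ _ _ cons_measure
  cons_measure_sigma_finite.

End tuple_product.

(* n-fold iterate of the library's binary product measure *)
Fixpoint lebesgue_tuple (R : realType) (n : nat) :
    {sigma_finite_measure set (n.-tuple (measurableTypeR R)) -> \bar R} :=
  if n is m.+1 then cons_measure lebesgue_measure (lebesgue_tuple R m)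
  else \d_([tuple] : 0.-tuple (measurableTypeR R)).

Section kernels.
Variable R : realType.
Implicit Types W : R -> R -> R.

Local Notation I := (`[0, 1]%classic : set R).

(* Only the values of W on [0,1]^2 are relevant. *)
Definition is_kernel W : Prop :=
  [/\ measurable_fun (I `*` I) (fun p : R * R => W p.1 p.2),
      forall x y, I x -> I y -> W x y = W y x &
      exists M : R, forall x y, I x -> I y -> `|W x y| <= M].

Definition is_kernel1 W : Prop :=
  is_kernel W /\ forall x y, I x -> I y -> -1 <= W x y <= 1.

Definition unit_cube (n : nat) : set (n.-tuple (measurableTypeR R)) :=
  [set x | forall i : 'I_n, I (tnth x i)].
Arguments unit_cube : clear implicits.

(* Coordinates are indexed by the vertices through enum_rank; ordering the
   endpoints by rank makes each edge ij contribute exactly one factor. *)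
Definition hom_density (F : sgraph) W : R :=
  \int[lebesgue_tuple R #|F|]_(x in unit_cube #|F|)
    \prod_(ij : F * F | adj ij.1 ij.2 && (enum_rank ij.1 < enum_rank ij.2)%N)
      W (tnth x (enum_rank ij.1)) (tnth x (enum_rank ij.2)).

Definition weakly_locally_common (F : sgraph) : Prop :=
  forall U, is_kernel1 U -> exists2 eU : R, 0 < eU &
    forall e : R, 0 <= e <= eU ->
      hom_density F (fun x y => 1 + e * U x y) +
      hom_density F (fun x y => 1 - e * U x y) >= 2.

End kernels.

(* Main.v *)
Require Import Defs.
From mathcomp Require Import all_boot all_order all_algebra.
From mathcomp Require Import all_classical all_reals all_analysis.
From mathcomp Require Import measurable_realfun.
From mathcomp Require Import ring lra.
Set Implicit Arguments.
Unset Strict Implicit.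
Unset Printing Implicit Defensive.
Import Order.TTheory GRing.Theory Num.Theory.
Local Open Scope classical_set_scope.
Local Open Scope ring_scope.

(** The counterexample [tripent] is a triangle and a pentagon sharing one vertex.

    Let U be a symmetric kernel whose degrees (integrals over one variable)
    vanish.  Expanding t(F, 1 + eU) over the sets of edges of F, every set
    spanning a subgraph with a vertex of degree one contributes zero.  In
    [tripent] only the empty set, the triangle, the pentagon and the whole graph
    remain, of sizes 0, 3, 5 and 8, so the average of the densities at e and -e
    is 1 + e^8 t(F, U).  It is enough to make t(F, U) negative.

    If U is moreover invariant under a transitive group, the density of closed
    walks through a point does not depend on the point and t(F, U) is the
    product of t(C_3, U) and t(C_5, U), that is, of the sum of the cubes and the
    sum of the fifth powers of the eigenvalues of U.  Cubing favours many
    moderate eigenvalues, the fifth power favours a single large one: with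
    eigenvalues proportional to -5, 4, 4 the cubes sum to 3 > 0 and the fifth
    powers to -1077 < 0.  Such a U lives on the Klein four-group, whose three
    non-trivial characters are the eigenfunctions and have mean zero, which also
    gives the vanishing degrees.  Cutting [0, 1] into four intervals of length
    1/4 indexed by this group turns U into a step function on the square
    ([klein_kernel]).

    The expansion over edge sets need not be carried out.  The kernel 1 + eU has
    the same eigenfunctions, with the eigenvalues of U scaled by e and eigenvalue
    1 on the constant function, so closed walks in it are again power sums
    ([walk_sum_spectral]), and the density factors over the two cycles as
    (1 + 3 t^3)(1 - 1077 t^5) with t = e / 13 ([tripent_density_perturbed]).
    What links this computation to the integral is [hom_density_step]: the
    density of a step kernel is a finite weighted sum over maps from the vertices
    to the steps. *)

(** * The triangle and the pentagon glued at a vertex *)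

Definition tripent_edges : seq (nat * nat) :=
  [:: (0, 1); (1, 2); (0, 2); (0, 3); (3, 4); (4, 5); (5, 6); (0, 6)]%N.

Definition tripent_adj (i j : 'I_7) : bool :=
  ((i : nat, j : nat) \in tripent_edges) ||
  ((j : nat, i : nat) \in tripent_edges).

Lemma tripent_adj_sym : symmetric tripent_adj.
Proof. by move=> i j; rewrite /tripent_adj orbC. Qed.

Lemma tripent_adj_irr : irreflexive tripent_adj.
Proof. by case=> [[|[|[|[|[|[|[|n]]]]]]] hn]. Qed.

Definition tripent : sgraph := SGraph tripent_adj_sym tripent_adj_irr.

Lemma tripent_connected : connected_graph tripent.
Proof.
split; first by rewrite card_ord.
have c0 (y : tripent) : connect (@adj tripent) (@Ordinal 7 0 isT) y.
  have st (i j : 'I_7) : tripent_adj i j ->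
      connect (@adj tripent) (@Ordinal 7 0 isT) i ->
      connect (@adj tripent) (@Ordinal 7 0 isT) j.
    by move=> /(@connect1 _ (@adj tripent)) ij /connect_trans; apply.
  have c1 := st (@Ordinal 7 0 isT) (@Ordinal 7 1 isT) isT (connect0 _ _).
  have c2 := st (@Ordinal 7 0 isT) (@Ordinal 7 2 isT) isT (connect0 _ _).
  have c3 := st (@Ordinal 7 0 isT) (@Ordinal 7 3 isT) isT (connect0 _ _).
  have c6 := st (@Ordinal 7 0 isT) (@Ordinal 7 6 isT) isT (connect0 _ _).
  have c4 := st (@Ordinal 7 3 isT) (@Ordinal 7 4 isT) isT c3.
  have c5 := st (@Ordinal 7 4 isT) (@Ordinal 7 5 isT) isT c4.
  case: y => [[|[|[|[|[|[|[|n]]]]]]] hn] //;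
    by rewrite (bool_irrelevance hn isT).
move=> x y; apply: (connect_trans _ (c0 y)).
by rewrite (sym_connect_sym (@adj_sym tripent)) c0.
Qed.

Lemma tripent_no_isolated_node : no_isolated_node tripent.
Proof.
case=> [[|[|[|[|[|[|[|n]]]]]]] hn] //.
- by exists (@Ordinal 7 1 isT).
- by exists (@Ordinal 7 0 isT).
- by exists (@Ordinal 7 0 isT).
- by exists (@Ordinal 7 0 isT).
- by exists (@Ordinal 7 3 isT).
- by exists (@Ordinal 7 4 isT).
- by exists (@Ordinal 7 0 isT).
Qed.

(** The labelling [v] is defined on all of [nat] so that its values at the seven
    vertices can be named by numerals.  Symmetry of [w] is what allows each cycle
    to be written as a closed walk. *)
Lemma tripent_edge_prod (R : comNzRingType) (T : Type) (w : T -> T -> R)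
    (v : nat -> T) :
  (forall x y, w x y = w y x) ->
  \prod_(ij : tripent * tripent |
      adj ij.1 ij.2 && (enum_rank ij.1 < enum_rank ij.2)%N)
     w (v (ij.1 : 'I_7)) (v (ij.2 : 'I_7)) =
  (w (v 0%N) (v 1%N) * w (v 1%N) (v 2%N) * w (v 2%N) (v 0%N)) *
  (w (v 0%N) (v 3%N) * w (v 3%N) (v 4%N) * w (v 4%N) (v 5%N) *
   w (v 5%N) (v 6%N) * w (v 6%N) (v 0%N)).
Proof.
move=> wC.
(* Every pair in the edge list is increasing, so the rank condition selects
   exactly the pairs in the list. *)
rewrite (eq_bigl (fun ij : 'I_7 * 'I_7 =>
    (ij.1 : nat, ij.2 : nat) \in tripent_edges)); last first.
  by move=> [[[|[|[|[|[|[|[|n]]]]]]] hn] [[|[|[|[|[|[|[|m]]]]]]] hm]] //;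
    rewrite !enum_rank_ord.
rewrite big_mkcond /=.
rewrite -(pair_bigA _ (fun i j : 'I_7 =>
  if (i : nat, j : nat) \in tripent_edges then w (v i) (v j) else 1)) /=.
do 8! rewrite ?big_ord_recl ?big_ord0 /=.
rewrite /bump /= /in_mem /= (wC (v 6%N)) (wC (v 2%N)); ring.
Qed.

(** The nesting of the pairs separates the shared vertex, the two other vertices
    of the triangle and the four other vertices of the pentagon, so that a sum
    over all labellings splits as soon as the shared label is fixed. *)
Definition assignment (T : Type) (p : T * ((T * T) * (T * (T * (T * T)))))
    (i : nat) : T :=
  nth p.1 [:: p.1; p.2.1.1; p.2.1.2;
    p.2.2.1; p.2.2.2.1; p.2.2.2.2.1; p.2.2.2.2.2] i.

Lemma sum_assignment (R : nmodType) (T : finType) (G : {ffun 'I_7 -> T} -> R) :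
  \sum_(phi : {ffun 'I_7 -> T}) G phi =
  \sum_p G [ffun i : 'I_7 => assignment p i].
Proof.
pose u k (h : (k < 7)%N) := Ordinal h.
apply: (@reindex _ _ _ _ _ (fun p => [ffun i : 'I_7 => assignment p i])).
exists (fun phi : {ffun 'I_7 -> T} =>
  (phi (@u 0 isT), ((phi (@u 1 isT), phi (@u 2 isT)),
    (phi (@u 3 isT), (phi (@u 4 isT), (phi (@u 5 isT), phi (@u 6 isT))))))).
  by move=> [a0 [[a1 a2] [a3 [a4 [a5 a6]]]]] _; rewrite !ffunE.
move=> phi _; apply/ffunP => i; rewrite ffunE /=.
by case: i => [[|[|[|[|[|[|[|n]]]]]]] hn] //=; congr (phi _); apply: val_inj.
Qed.

Lemma sum_pair (R : nmodType) (S T : finType) (f : S * T -> R) :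
  \sum_p f p = \sum_a \sum_b f (a, b).
Proof.
by rewrite (pair_bigA _ (fun a b => f (a, b))); apply: eq_bigr => -[].
Qed.

(** A walk of [k.+1] edges: this is the entry at [(a, b)] of the power [k.+1] of
    the matrix [w]. *)
Fixpoint walk_sum (R : nzSemiRingType) (T : finType) (w : T -> T -> R)
    (k : nat) (a b : T) : R :=
  if k is k'.+1 then \sum_c w a c * walk_sum w k' c b else w a b.

(** Once the label of the shared vertex is fixed, the labels on the triangle and
    those on the pentagon are independent. *)
Lemma tripent_sum (R : comNzRingType) (T : finType) (w : T -> T -> R) :
  (forall x y, w x y = w y x) ->
  \sum_(phi : {ffun tripent -> T})
    \prod_(ij : tripent * tripent |
        adj ij.1 ij.2 && (enum_rank ij.1 < enum_rank ij.2)%N)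
      w (phi ij.1) (phi ij.2) =
  \sum_a walk_sum w 2 a a * walk_sum w 4 a a.
Proof.
move=> wC; rewrite [LHS]sum_assignment.
under eq_bigr => p _.
  under eq_bigr => ij _ do rewrite !ffunE.
  rewrite tripent_edge_prod //; over.
rewrite sum_pair; apply: eq_bigr => a _.
rewrite sum_pair /assignment /= -big_distrlr /=; congr (_ * _).
  rewrite sum_pair; apply: eq_bigr => b _ /=.
  by rewrite mulr_sumr; apply: eq_bigr => c _; rewrite mulrA.
rewrite sum_pair; apply: eq_bigr => b _ /=.
rewrite sum_pair mulr_sumr; apply: eq_bigr => c _ /=.
rewrite sum_pair mulr_sumr mulr_sumr; apply: eq_bigr => d _ /=.
by rewrite !mulr_sumr; apply: eq_bigr => e _ /=; rewrite !mulrA.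
Qed.

(** * The density of a step kernel *)

(** Uniqueness of the index makes [f] equal on [D] to the sum of the functions
    [c j * \1_(B j)], and these are integrable because the parts have finite
    measure; the integral then follows by linearity. *)
Lemma Rintegral_step d (X : measurableType d) (R : realType)
    (mu : {measure set X -> \bar R}) (J : finType) (D : set X)
    (B : J -> set X) (c : J -> R) (f : X -> R) :
  measurable D -> (forall j, measurable (B j)) ->
  (forall j, B j `<=` D) -> (forall j, (mu (B j) < +oo)%E) ->
  (forall x, D x -> exists j, [/\ B j x, forall k, B k x -> k = j & f x = c j]) ->
  \int[mu]_(x in D) f x = \sum_j c j * fine (mu (B j)).
Proof.
move=> mD mB BD muB fD.
have int1B j : mu.-integrable D (fun x => (\1_(B j) x)%:E).
  apply/integrableP; split.
    by apply/measurable_EFinP; exact: measurable_indic.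
  under eq_integral do rewrite gee0_abs ?lee_fin //.
  by rewrite integral_indic // setIidl.
rewrite /Rintegral.
have -> : (\int[mu]_(x in D) (f x)%:E =
    \int[mu]_(x in D) \sum_j (c j)%:E * (\1_(B j) x)%:E)%E.
  apply: eq_integral => x; rewrite inE => /fD[j [Bj Bu ->]].
  rewrite (bigD1 j) //= big1 ?adde0 => [|k kj].
    by rewrite indicE mem_set // mule1.
  rewrite indicE memNset ?mule0 // => /Bu kj'.
  by rewrite kj' eqxx in kj.
rewrite integral_sum //=; last by move=> j; exact: integrableZl.
rewrite (eq_bigr (fun j => (c j * fine (mu (B j)))%:E)) ?sumEFin // => j _.
rewrite integralZl // integral_indic // setIidl // EFinM fineK //.
by rewrite ge0_fin_numE.
Qed.

Section step_density.
Variable R : realType.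
Local Notation I := (`[0, 1]%classic : set R).

Definition box n (A : 'I_n -> set R) : set (n.-tuple (measurableTypeR R)) :=
  [set x | forall i, A i (tnth x i)].

Lemma measurable_box n (A : 'I_n -> set R) :
  (forall i, measurable (A i)) -> measurable (box A).
Proof.
move=> mA.
have -> : box A = \bigcap_(i in [set: 'I_n]) ((fun x => tnth x i) @^-1` A i).
  by apply/seteqP; split => x Ax i; [move=> _|]; exact: Ax.
apply: fin_bigcap_measurable; first exact: finite_finset.
move=> i _; rewrite -[X in measurable X]setTI.
by apply: (measurable_tnth i) => //; exact: mA.
Qed.

Lemma lebesgue_tuple_box n (A : 'I_n -> set R) :
  (forall i, measurable (A i)) ->
  lebesgue_tuple R n (box A) = (\prod_(i < n) lebesgue_measure (A i))%E.
Proof.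
elim: n A => [|n IHn] A mA.
  by rewrite big_ord0 /= diracE mem_set // => -[].
rewrite big_ord_recl /= /cons_measure /pushforward.
have -> : @tuple_cons _ (measurableTypeR R) n @^-1` box A =
    A ord0 `*` box (fun i => A (lift ord0 i)).
  apply/seteqP; split => -[x t] /=.
    move=> Axt; split; first by have := Axt ord0; rewrite (tnth_nth 0).
    by move=> i; have := Axt (lift ord0 i); rewrite !(tnth_nth 0).
  move=> [Ax At] i; have [j ->|->] := unliftP ord0 i.
    by have := At j; rewrite !(tnth_nth 0).
  by rewrite (tnth_nth 0).
rewrite product_measure1E; [|exact: mA|exact: measurable_box].
by congr (_ * _)%E; apply: IHn.
Qed.

(** Recording the cell of each coordinate partitions the cube into boxes, one for
    each map from the vertices to the cells, and all of volume [p ^+ #|F|]. *)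
Lemma hom_density_step (F : sgraph) (T : finType) (cell : R -> T) (p : R)
    (w : T -> T -> R) :
  (forall a, measurable (I `&` cell @^-1` [set a])) ->
  (forall a, lebesgue_measure (I `&` cell @^-1` [set a]) = p%:E) ->
  hom_density F (fun x y => w (cell x) (cell y)) =
  p ^+ #|F| * \sum_(phi : {ffun F -> T})
    \prod_(ij : F * F | adj ij.1 ij.2 && (enum_rank ij.1 < enum_rank ij.2)%N)
      w (phi ij.1) (phi ij.2).
Proof.
move=> mC pC.
pose B (phi : {ffun F -> T}) :=
  box (fun i : 'I_#|F| => I `&` cell @^-1` [set phi (enum_val i)]).
have muB phi : lebesgue_tuple R #|F| (B phi) = (p ^+ #|F|)%:E.
  rewrite lebesgue_tuple_box //.
  under eq_bigr do rewrite pC.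
  by rewrite prodEFin prodr_const card_ord.
rewrite /hom_density (Rintegral_step (B := B)
  (c := fun phi => \prod_(ij : F * F |
     adj ij.1 ij.2 && (enum_rank ij.1 < enum_rank ij.2)%N)
      w (phi ij.1) (phi ij.2))).
- rewrite mulr_sumr; apply: eq_bigr => phi _; rewrite mulrC; congr (_ * _).
  exact: (congr1 fine (muB phi)).
- by apply: (@measurable_box _ (fun=> I)).
- by move=> phi; apply: measurable_box.
- by move=> phi x Bx i; have [] := Bx i.
- move=> phi; apply: (@le_lt_trans _ _ (p ^+ #|F|)%:E).
    by rewrite -(muB phi).
  exact: ltry.
move=> x Dx; exists [ffun i : F => cell (tnth x (enum_rank i))]; split.
- by move=> i; split; [exact: Dx|rewrite /= ffunE enum_valK].
- move=> phi Bx; apply/ffunP => i; rewrite ffunE.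
  by have [_ /= ->] := Bx (enum_rank i); rewrite enum_rankK.
- by apply: eq_bigr => ij _; rewrite !ffunE.
Qed.

End step_density.

(** * A kernel with eigenvalues -5, 4, 4 on the Klein four-group *)

Section klein_kernel.
Variable R : realType.
Local Notation I := (`[0, 1]%classic : set R).

(** The group is [bool * bool] with componentwise exclusive or.  Its three
    non-trivial characters are eigenfunctions with eigenvalues [p], [q], [r], and
    the constant function is one with eigenvalue 1, where the composition of
    kernels averages over the group. *)
Definition spectral (p q r : R) (a b : bool * bool) : R :=
  1 + p * ((-1) ^+ a.1 * (-1) ^+ b.1) + q * ((-1) ^+ a.2 * (-1) ^+ b.2)
    + r * ((-1) ^+ (a.1 (+) a.2) * (-1) ^+ (b.1 (+) b.2)).

Lemma spectral_sym p q r a b : spectral p q r a b = spectral p q r b a.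
Proof. by rewrite /spectral; ring. Qed.

(** Characters have modulus one, so the diagonal is the constant trace. *)
Lemma spectral_diag p q r a : spectral p q r a a = 1 + p + q + r.
Proof. by case: a => [[] []]; rewrite /spectral /= ?expr0 ?expr1; ring. Qed.

(** Characters are orthogonal with squared norm 4 for the counting measure, so
    composing two such kernels multiplies their eigenvalues. *)
Lemma spectral_comp p q r p' q' r' a b :
  \sum_c spectral p q r a c * spectral p' q' r' c b =
  4 * spectral (p * p') (q * q') (r * r') a b.
Proof.
rewrite sum_pair /= !big_bool.
case: a => [[] []]; case: b => [[] []];
by rewrite /spectral /= ?expr0 ?expr1; ring.
Qed.

Lemma walk_sum_spectral p q r k a b :
  walk_sum (spectral p q r) k a b =
  4 ^+ k * spectral (p ^+ k.+1) (q ^+ k.+1) (r ^+ k.+1) a b.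
Proof.
elim: k a => [|k IHk] a; first by rewrite /= mul1r.
rewrite [LHS]/=; under eq_bigr do rewrite IHk mulrCA.
by rewrite -mulr_sumr spectral_comp -!exprS mulrA -exprSr.
Qed.

Definition cell (x : R) : bool * bool := (x < 1/2, (1/4 <= x) && (x < 3/4)).

(** All four intervals are closed on the left; only the last one is closed on the
    right, hence the boolean. *)
Lemma cell_itv a : exists (u : R) b,
  I `&` cell @^-1` [set a] = [set` Interval (BLeft u) (BSide b (u + 1/4))].
Proof.
have H u b : (forall x, [/\ 0 <= x, x <= 1 & cell x = a] <->
      x \in Interval (BLeft u) (BSide b (u + 1/4))) ->
   exists (u : R) b,
  I `&` cell @^-1` [set a] = [set` Interval (BLeft u) (BSide b (u + 1/4))].
  move=> h; exists u, b; apply/seteqP; split => x /=; rewrite -h in_itv /=.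
    by move=> [/andP[]].
  by move=> [-> ->].
case: a H => [[] []] H; [apply: (H (1/4) true)|apply: (H 0 true)|
  apply: (H (1/2) true)|apply: (H (3/4) false)] => x;
 rewrite /cell in_itv /=; (split=> [[u v]|/andP[u v]];
 [|split; [lra|lra|]]);
 case: (ltP x (1/2)) => h1; case: (leP (1/4) x) => h2;
 case: (ltP x (3/4)) => h3; do ?[by [] | by exfalso; lra];
 by move=> _ /=; try (apply/andP; split); lra.
Qed.

Lemma measurable_cell a : measurable (I `&` cell @^-1` [set a]).
Proof. by have [u [b ->]] := cell_itv a. Qed.

Lemma lebesgue_measure_cell a :
  lebesgue_measure (I `&` cell @^-1` [set a]) = (1/4)%:E.
Proof.
have [u [b ->]] := cell_itv a; rewrite lebesgue_measure_itv /= lte_fin.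
by rewrite ltrDl ifT ?divr_gt0 // -EFinB; congr EFin; lra.
Qed.

(** The entries of the matrix with eigenvalues -5, 4, 4 and 0 are 3, -13, 5, 5;
    dividing by 13 brings them into [-1, 1]. *)
Definition klein_kernel (x y : R) : R :=
  (spectral (- 5) 4 4 (cell x) (cell y) - 1) / 13.

Lemma is_kernel1_klein_kernel : is_kernel1 klein_kernel.
Proof.
have bnd x y : -1 <= klein_kernel x y <= 1.
  rewrite /klein_kernel; case: (cell x) => [[] []]; case: (cell y) => [[] []];
  by rewrite /spectral /= ?expr0 ?expr1; apply/andP; split; lra.
split; last by move=> x y _ _.
split; last by exists 1 => x y _ _; rewrite ler_norml.
  have m1 : measurable_fun setT (fun x : R => (-1) ^+ (cell x).1 : R).
    rewrite (_ : (fun _ => _) =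
        fun x : R => if x < 1/2 then -1 else 1); last first.
      by apply/funext => x /=; case: ifP; rewrite ?expr0 ?expr1.
    by apply: measurable_fun_ifT => //; exact: measurable_fun_ltr.
  have m2 : measurable_fun setT (fun x : R => (-1) ^+ (cell x).2 : R).
    rewrite (_ : (fun _ => _) =
        fun x : R => if (1/4 <= x) && (x < 3/4) then -1 else 1); last first.
      by apply/funext => x /=; case: ifP; rewrite ?expr0 ?expr1.
    apply: measurable_fun_ifT => //; apply: measurable_and.
      exact: measurable_fun_ler.
    exact: measurable_fun_ltr.
  apply: measurable_funTS; rewrite /klein_kernel /spectral.
  under eq_fun do rewrite !signr_addb.
  have f1 : measurable_fun setT (fun p : R * R => (-1) ^+ (cell p.1).1 : R).
    by apply: (measurableT_comp m1).
  have f2 : measurable_fun setT (fun p : R * R => (-1) ^+ (cell p.1).2 : R).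
    by apply: (measurableT_comp m2).
  have s1 : measurable_fun setT (fun p : R * R => (-1) ^+ (cell p.2).1 : R).
    by apply: (measurableT_comp m1).
  have s2 : measurable_fun setT (fun p : R * R => (-1) ^+ (cell p.2).2 : R).
    by apply: (measurableT_comp m2).
  by do ![apply: measurable_funM | apply: measurable_funD
         | apply: measurable_funB | by []].
by move=> x y _ _; rewrite /klein_kernel spectral_sym.
Qed.

End klein_kernel.

(** * The density and the counterexample *)

Lemma tripent_density (R : realType) (p q r : R) :
  hom_density tripent (fun x y => spectral p q r (cell x) (cell y)) =
  (1 + p ^+ 3 + q ^+ 3 + r ^+ 3) * (1 + p ^+ 5 + q ^+ 5 + r ^+ 5).
Proof.
rewrite (hom_density_step tripent (spectral p q r)
  (@measurable_cell R) (@lebesgue_measure_cell R)).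
rewrite tripent_sum; last exact: spectral_sym.
under eq_bigr do rewrite !walk_sum_spectral !spectral_diag.
by rewrite sumr_const card_prod card_bool card_ord -mulr_natl; field.
Qed.

(** With t = e / 13 the eigenvalues of e times [klein_kernel] are -5t, 4t, 4t.
    The whole point of the numbers 5, 4, 4 is that their third power sum,
    -125 + 64 + 64 = 3, and their fifth, -3125 + 1024 + 1024 = -1077, have
    opposite signs. *)
Lemma tripent_density_perturbed (R : realType) (e : R) :
  hom_density tripent (fun x y => 1 + e * klein_kernel x y) =
  (1 + 3 * (e / 13) ^+ 3) * (1 - 1077 * (e / 13) ^+ 5).
Proof.
transitivity (hom_density tripent (fun x y : R =>
    spectral (- 5 * (e / 13)) (4 * (e / 13)) (4 * (e / 13)) (cell x) (cell y))).
  congr hom_density; apply/funext => x; apply/funext => y.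
  by rewrite /klein_kernel /spectral; field.
by rewrite tripent_density; ring.
Qed.

Theorem proposition4p3 (R : realType) :
  exists F : sgraph,
    [/\ connected_graph F, no_isolated_node F & ~ weakly_locally_common R F].
Proof.
exists tripent.
split; [exact: tripent_connected|exact: tripent_no_isolated_node|].
move=> /(_ _ (@is_kernel1_klein_kernel R))[e e0] /(_ e).
rewrite lexx ltW // => /(_ isT).
have -> : (fun x y => 1 - e * klein_kernel x y) =
    (fun x y => 1 + (- e) * klein_kernel x y).
  by apply/funext => x; apply/funext => y; rewrite mulNr.
rewrite !tripent_density_perturbed mulNr leNgt => /negP; apply.
have s8 : 0 < (e / 13) ^+ 8 by rewrite exprn_gt0 // divr_gt0.
(* The odd powers cancel, and 6462 = 2 * 3 * 1077. *)
rewrite (_ : _ + _ = 2 - 6462 * (e / 13) ^+ 8); last by ring.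
by lra.
Qed.
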